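(* Let $U, V, W$ be finite-dimensional real vector spaces (of arbitrary dimensions), let $B: U \to V$ and $A: V \to W$ be linear maps, and let $n$ be a positive integer. Let $N = \dim V$ and let $f_1, \ldots, f_N$ be a basis of $V$. Let $\mathcal{S}_n(N)$ be the set of subsets of $\{1,\ldots,N\}$ of size $n$. For $\sigma \in \mathcal{S}_n(N)$ let $V_\sigma$ be the span of $\{f_i : i \in \sigma\}$, let $P_\sigma : V \to V_\sigma$ be the projection of $V$ onto $V_\sigma$ along the span of $\{f_i : i \in \{1,\ldots,N\}\setminus \sigma\}$, and let $E_\sigma : V_\sigma \to V$ be the inclusion. Then, as linear maps $\bigwedge^n W \to \bigwedge^n U$, $$(AB)^* = \sum_{\sigma \in \mathcal{S}_n(N)} (P_\sigma B)^* (A E_\sigma)^*,$$ where $^*$ denotes the $n$-th level dual.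
   Context: For a finite-dimensional real vector space $X$ and a positive integer $n$, $\bigwedge^n X$ denotes the vector space of alternating $n$-linear maps $\omega : X^n \to \mathbb{R}$. For a linear map $F: X \to Y$, the $n$-th level dual $F^* : \bigwedge^n Y \to \bigwedge^n X$ is the linear map defined by $F^*\omega[x_1,\ldots,x_n] = \omega[Fx_1,\ldots,Fx_n]$. *)

(* Defs.v *)
From HB Require Import structures.
From mathcomp Require Import all_boot all_order all_algebra.
From mathcomp Require Import boolp functions reals.

Set Implicit Arguments.
Unset Strict Implicit.
Unset Printing Implicit Defensive.

Import GRing.Theory.
Local Open Scope ring_scope.

(* Alternating is taken in the form "vanishes when two arguments coincide",
   which over R is the same as "changes sign when two arguments are swapped". *)
Definition multilinear (R : fieldType) (X : vectType R) (n : nat)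
    (w : {ffun 'I_n -> X} -> R^o) : Prop :=
  forall (x : {ffun 'I_n -> X}) (i : 'I_n),
    linear (fun y : X => w [ffun j => if j == i then y else x j]).

Definition alternating (R : fieldType) (X : vectType R) (n : nat)
    (w : {ffun 'I_n -> X} -> R^o) : Prop :=
  forall (x : {ffun 'I_n -> X}) (i j : 'I_n), i != j -> x i = x j -> w x = 0.

Definition is_altform (R : fieldType) (X : vectType R) (n : nat)
    : {pred ({ffun 'I_n -> X} -> R^o)} :=
  fun w => `[< multilinear w /\ alternating w >].
Arguments is_altform {R X n} _.

Fact is_altform_submod (R : fieldType) (X : vectType R) (n : nat) :
  subsemimod_closed (@is_altform R X n).
Proof.
split; [split|].
- apply/asboolP; split=> [x i a y z|x i j _ _] //=.
  by rewrite /GRing.zero /= scaler0 addr0.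
- move=> v w /asboolP[mv av] /asboolP[mw aw]; apply/asboolP; split.
    move=> x i a y z /=.
    by rewrite !addrfctE mv mw scalerDr addrACA.
  by move=> x i j nij xij; rewrite addrfctE (av x i j) ?(aw x i j) ?addr0.
- move=> c w /asboolP[mw aw]; apply/asboolP; split.
    move=> x i a y z /=.
    by rewrite !scalrfctE mw scalerDr !scalerA mulrC.
  by move=> x i j nij xij; rewrite scalrfctE (aw x i j) ?scaler0.
Qed.

HB.instance Definition _ (R : fieldType) (X : vectType R) (n : nat) :=
  GRing.isSubmodClosed.Build R ({ffun 'I_n -> X} -> R^o) (@is_altform R X n)
    (@is_altform_submod R X n).

(* The space of alternating n-linear forms on X. *)
Record altform (R : fieldType) (X : vectType R) (n : nat) := AltForm {
  altform_fun :> {ffun 'I_n -> X} -> R^o;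
  altform_in : altform_fun \in is_altform }.

HB.instance Definition _ (R : fieldType) (X : vectType R) (n : nat) :=
  [isSub for @altform_fun R X n].
HB.instance Definition _ (R : fieldType) (X : vectType R) (n : nat) :=
  [Choice of altform X n by <:].
HB.instance Definition _ (R : fieldType) (X : vectType R) (n : nat) :=
  [SubChoice_isSubLmodule of altform X n by <:].

Section AltformTheory.
Variables (R : fieldType) (X : vectType R) (n : nat).
Implicit Types (w : altform X n) (x : {ffun 'I_n -> X}).

Lemma altform_multilinear w : multilinear w.
Proof. by have /asboolP[] := altform_in w. Qed.

Lemma altform_alternating w : alternating w.
Proof. by have /asboolP[] := altform_in w. Qed.

Lemma altformP w w' : (forall x, w x = w' x) -> w = w'.
Proof. by move=> eww'; apply/val_inj/funext. Qed.

Lemma altformDE w w' x : (w + w') x = w x + w' x. Proof. by []. Qed.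
Lemma altformZE a w x : (a *: w) x = a * w x. Proof. by []. Qed.

Let d : nat := \dim {:X}.
Let basisX : {ffun 'I_d -> X} := [ffun i : 'I_d => (vbasis {:X})`_i].
Let coordsT : vectType R := {ffun {ffun 'I_n -> 'I_d} -> R^o}.

Let coords w : coordsT := [ffun s : {ffun 'I_n -> 'I_d} => w [ffun i => basisX (s i)]].

Let coords_linear : linear coords.
Proof. by move=> a v w; apply/ffunP=> s; rewrite !ffunE. Qed.
HB.instance Definition _ := GRing.isLinear.Build R (altform X n) coordsT _ coords
  coords_linear.

Let coords_inj : injective coords.
Proof.
apply: raddf_inj => w /ffunP w0.
have wbasis s : w [ffun i => basisX (s i)] = 0.
  have := w0 (finfun s); rewrite !ffunE => <-.
  by congr (altform_fun w _); apply/ffunP => i; rewrite !ffunE.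
suff wk k : forall x, #|[pred i | x i \notin codom basisX]| = k -> w x = 0.
  by apply: altformP => x; rewrite (wk _ _ erefl).
elim: k => [|k IHk] x.
  move=> /card0_eq x0.
  have xb i : exists j, x i = basisX j.
    by have := x0 i; rewrite !inE => /negbFE/codomP.
  have [s xs] := choice xb.
  by rewrite -[RHS](wbasis s); congr (altform_fun w _); apply/ffunP => i; rewrite ffunE.
move=> xk.
have /card_gt0P[i] : (0 < #|[pred i | x i \notin codom basisX]|)%N by rewrite xk.
rewrite inE => xi.
have -> : x = [ffun j => if j == i then x i else x j].
  by apply/ffunP => j; rewrite ffunE; case: eqP => [->|].
pose phi (y : X) : R^o := w [ffun j => if j == i then y else x j].
have phil : linear phi by exact: altform_multilinear.
pose phiL := GRing.isLinear.Build R X R^o _ phi phil.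
pose phi' : {linear X -> R^o} := HB.pack phi phiL.
rewrite -[LHS]/(phi' (x i)) (coord_vbasis (memvf (x i))) linear_sum big1 // => j _.
rewrite linearZ_LR; suff -> : phi' (vbasis {:X})`_j = 0 by rewrite scaler0.
apply: IHk; apply: succn_inj; rewrite -xk.
rewrite [RHS](cardD1 i) inE xi add1n; congr _.+1; apply: eq_card => l.
rewrite !inE ffunE; case: eqP => //= _.
by apply/negbTE; rewrite negbK; apply/codomP; exists j; rewrite ffunE.
Qed.

(* Finite-dimensionality: coords embeds altform X n into a finite-dimensional
   space, and its image is a subspace of maximal dimension contained in it. *)
Fact altform_findim : {m : nat & Vector.axiom m (altform X n)}.
Proof.
pose P m := `[< exists2 S : {vspace coordsT},
  \dim S = m & forall v, v \in S -> exists w, coords w = v >].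
have P0 : exists m, P m.
  exists 0; apply/asboolP; exists 0%VS; first exact: dimv0.
  by move=> v; rewrite memv0 => /eqP->; exists 0; rewrite linear0.
have Pub m : P m -> (m <= \dim {:coordsT})%N.
  by move=> /asboolP[S <- _]; exact/dimvS/subvf.
have [m /asboolP Pm maxm] := ex_maxnP P0 Pub.
have /cid2[S dimS Sim] := Pm.
have imS w : coords w \in S.
  apply: contraT => wS; have : (\dim (S + <[coords w]>) <= m)%N.
    apply: maxm; apply/asboolP; exists (S + <[coords w]>)%VS => // v.
    case/memv_addP => u /Sim[w1 <-] [_ /vlineP[a ->] ->].
    by exists (w1 + a *: w); rewrite linearD linearZ.
  rewrite dimv_disjoint_sum ?dimS ?dim_vline.
    case: eqP => [w0|_]; first by rewrite w0 mem0v in wS.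
    by rewrite addn1 ltnn.
  apply/eqP; rewrite -subv0; apply/subvP => v /memv_capP[vS /vlineP[a va]].
  rewrite memv0; apply: contraNT wS => v0.
  have a0 : a != 0 by apply: contraNneq v0 => a0; rewrite va a0 scale0r.
  by rewrite -[coords w](scalerK a0) -va memvZ.
exists (\dim S).
exists (fun w => \row_i coord (vbasis S) i (coords w)).
  by move=> a v w; apply/rowP => i; rewrite !mxE linearP linearP.
have inv (r : 'rV[R]_(\dim S)) : exists w, coords w = \sum_i r 0 i *: (vbasis S)`_i.
  apply: Sim; apply: rpred_sum => i _; apply/rpredZ/vbasis_mem/mem_nth.
  by rewrite size_tuple.
have [g gP] := choice inv.
exists g => [w|r].
  apply: coords_inj; rewrite gP [RHS](coord_vbasis (imS w)).
  by apply: eq_bigr => i _; rewrite mxE.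
apply/rowP => i; rewrite mxE gP coord_sum_free //.
exact/basis_free/vbasisP.
Qed.

HB.instance Definition _ := Lmodule_hasFinDim.Build R (altform X n)
  (projT2 altform_findim).

End AltformTheory.

Section Dual.
Variables (R : fieldType) (X Y : vectType R) (n : nat) (F : 'Hom(X, Y)).

Definition pullback_fun (w : altform Y n) : {ffun 'I_n -> X} -> R^o :=
  fun x => w [ffun i => F (x i)].

Fact pullback_subproof (w : altform Y n) : pullback_fun w \in is_altform.
Proof.
apply/asboolP; split=> [x i a y z|x i j nij xij]; rewrite /pullback_fun.
  have FE t : [ffun k => F ([ffun j => if j == i then t else x j] k)] =
              [ffun j => if j == i then F t else [ffun k => F (x k)] j].
    by apply/ffunP => k; rewrite !ffunE; case: eqP.
  by rewrite !FE linearP; exact: altform_multilinear.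
by apply: (altform_alternating w nij); rewrite !ffunE xij.
Qed.

Definition pullback (w : altform Y n) : altform X n :=
  AltForm (pullback_subproof w).

Fact pullback_linear : linear pullback.
Proof. by move=> a v w; apply: altformP. Qed.
HB.instance Definition _ := GRing.isLinear.Build R (altform Y n) (altform X n) _
  pullback pullback_linear.

Definition dual : 'Hom(altform Y n, altform X n) := linfun pullback.

Lemma dualE (w : altform Y n) (x : {ffun 'I_n -> X}) :
  dual w x = w [ffun i => F (x i)].
Proof. by rewrite lfunE. Qed.

End Dual.

Arguments dual {R X Y} n F.

Section BasisSubspace.
Variables (R : fieldType) (V : vectType R) (N : nat) (f : N.-tuple V).
Implicit Type s : {set 'I_N}.

Definition spanset s : {vspace V} := <<[seq tnth f i | i in s]>>%VS.

(* Projection onto spanset s along spanset (~: s), with codomain spanset s;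
   vsproj only corestricts, since daddv_pi already takes values in spanset s. *)
Definition projset s : 'Hom(V, subvs_of (spanset s)) :=
  (linfun (@vsproj R V (spanset s)) \o daddv_pi (spanset s) (spanset (~: s)))%VF.

Definition inclset s : 'Hom(subvs_of (spanset s), V) :=
  linfun (@vsval R V (spanset s)).

Lemma val_projset s v :
  vsval (projset s v) = daddv_pi (spanset s) (spanset (~: s)) v.
Proof. by rewrite comp_lfunE lfunE /= vsprojK ?memv_pi. Qed.

Lemma projset_basis s i : basis_of {:V} f ->
  vsval (projset s (tnth f i)) = if i \in s then tnth f i else 0.
Proof.
move=> fV; rewrite val_projset.
have memspan (t : {set 'I_N}) : i \in t -> tnth f i \in spanset t.
  by move=> it; apply/memv_span/imageP; exists i.
have disj : (spanset s :&: spanset (~: s) = 0)%VS.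
  have := basis_free fV; have -> : (f : seq V) = [seq tnth f i | i <- enum 'I_N].
    by rewrite -[in LHS](map_tnth_enum f).
  have pe : perm_eq [seq tnth f i | i <- enum 'I_N]
      ([seq tnth f i | i in s] ++ [seq tnth f i | i in ~: s]).
    rewrite /image_mem -map_cat perm_map //.
    apply: uniq_perm; rewrite ?enum_uniq // ?cat_uniq ?enum_uniq /= ?andbT.
      by apply/hasPn => k; rewrite !mem_enum inE.
    by move=> k; rewrite mem_cat !mem_enum !inE orbN.
  by rewrite (perm_free pe) cat_free => /and3P[_ _ /directv_addP].
case: ifPn => is_.
  by rewrite daddv_pi_id ?memspan.
have isC : tnth f i \in spanset (~: s) by rewrite memspan ?inE.
have := daddv_pi_add disj (subvP (addvSr _ _) _ isC).
rewrite (@daddv_pi_id _ _ (spanset (~: s)) (spanset s)) ?[(spanset (~: s) :&: _)%VS]capvC //.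
by move/(canRL (addrK _)); rewrite subrr.
Qed.

End BasisSubspace.

(* Main.v *)
(* Composing with A and B on either side reduces the identity to U = V = W, where
   it says that w = \sum_s (E_s P_s)^* w for every alternating n-form w on V.
   Two alternating forms are equal as soon as they agree on the tuples
   (f_(g 0), ..., f_(g (n-1))) with g injective, and there the only s with
   #|s| = n whose term does not vanish is the image of g. *)
Require Import Defs.
From HB Require Import structures.
From mathcomp Require Import all_boot all_order all_algebra.
From mathcomp Require Import boolp functions reals.
Import GRing.Theory.
Local Open Scope ring_scope.

Section MultilinearBasis.
Set Implicit Arguments.
Unset Strict Implicit.
Variables (R : fieldType) (V : vectType R) (n : nat).

Lemma multilinear_eq0_at (w : {ffun 'I_n -> V} -> R^o) (x : {ffun 'I_n -> V})
    (i : 'I_n) :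
  multilinear w -> x i = 0 -> w x = 0.
Proof.
(* With scalar [-1] and both vectors [0], linearity in slot [i] reads [w x = - w x + w x]. *)
move=> wlin xi0; have := wlin x i (-1) 0 0.
rewrite scaler0 addr0 scaleN1r addNr.
suff -> : [ffun j => if j == i then 0 else x j] = x by [].
by apply/ffunP => j; rewrite ffunE; case: eqP => // ->.
Qed.

(** Induction on the number of arguments outside the basis: expanding one such argument in [f]
    leaves terms with fewer of them. *)
Lemma multilinear_basis_eq0 (N : nat) (f : N.-tuple V)
    (w : {ffun 'I_n -> V} -> R^o) :
  basis_of fullv f -> multilinear w ->
  (forall g : 'I_n -> 'I_N, w [ffun i => tnth f (g i)] = 0) ->
  forall x, w x = 0.
Proof.
move=> f_basis wlin w0 x.
have [k] := ubnP #|[pred i | x i \notin f]|; elim: k => // k IHk in x *.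
rewrite ltnS => xk.
case: (pickP [pred i | x i \notin f]) => [i xi|xf].
  pose phi (y : V) : R^o := w [ffun j => if j == i then y else x j].
  (* Packed as a linear map, so that [linear_sum] applies to the expansion of [x i]. *)
  pose phiL := GRing.isLinear.Build R V R^o _ phi (wlin x i).
  pose phi' : {linear V -> R^o} := HB.pack phi phiL.
  have -> : w x = phi' (x i).
    congr w; apply/ffunP => j; rewrite ffunE.
    by case: eqP => [->|].
  rewrite (coord_basis f_basis (memvf (x i))) linear_sum big1 // => j _.
  rewrite linearZ_LR [phi' _]IHk ?scaler0 //.
  apply: leq_trans xk; rewrite [leqRHS](cardD1 i) [i \in _]xi add1n ltnS.
  apply: subset_leq_card; apply/subsetP => l; rewrite !inE ffunE.
  by case: eqP => //= _; rewrite mem_nth // size_tuple.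
have xg i : exists j, x i = tnth f j by apply/tnthP/negbFE/xf.
have [g gP] := choice xg.
by rewrite -(w0 g); congr w; apply/ffunP => i; rewrite ffunE.
Qed.

(** Injective [g] suffice: for any other [g] the tuple repeats a vector, and the alternating form
    [w - w'] vanishes there. *)
Lemma altform_eq_basis (N : nat) (f : N.-tuple V) (w w' : altform V n) :
  basis_of fullv f ->
  (forall g : 'I_n -> 'I_N, injective g ->
     w [ffun i => tnth f (g i)] = w' [ffun i => tnth f (g i)]) ->
  w = w'.
Proof.
move=> f_basis eqw; apply/eqP; rewrite -subr_eq0; apply/eqP/altformP => x.
apply: (multilinear_basis_eq0 f_basis (altform_multilinear _)) => g.
have [ginj|] := boolP (injectiveb g).
  rewrite -scaleN1r altformDE altformZE mulN1r.
  by rewrite eqw ?subrr //; apply/injectiveP.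
case/injectivePn => i [j nij gij].
by apply: (altform_alternating _ nij); rewrite !ffunE gij.
Qed.

End MultilinearBasis.

Section DualBasis.
Set Implicit Arguments.
Unset Strict Implicit.
Variable R : fieldType.

Lemma dual_comp (n : nat) (X Y Z : vectType R) (G : 'Hom(Y, Z)) (F : 'Hom(X, Y)) :
  dual n (G \o F)%VF = (dual n F \o dual n G)%VF.
Proof.
apply/lfunP => w; apply: altformP => x; rewrite comp_lfunE !dualE.
by congr (altform_fun w _); apply/ffunP => i; rewrite !ffunE comp_lfunE.
Qed.

Lemma sum_altformE (X : vectType R) (n : nat) (I : finType) (P : pred I)
    (w : I -> altform X n) (x : {ffun 'I_n -> X}) :
  (\sum_(i | P i) w i) x = \sum_(i | P i) w i x.
Proof.
by apply: (big_morph (fun v : altform X n => v x)) => // v v'; rewrite altformDE.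
Qed.

Lemma dual_projset_sum (V : vectType R) (n N : nat) (f : N.-tuple V) :
  basis_of fullv f ->
  \sum_(s : {set 'I_N} | #|s| == n)
      (dual n (projset f s) \o dual n (inclset f s))%VF = \1%VF.
Proof.
move=> f_basis; apply/lfunP => w; rewrite sum_lfunE id_lfunE.
apply: (altform_eq_basis f_basis) => g ginj.
rewrite sum_altformE.
pose S := [set g i | i in 'I_n]; have cardS : #|S| = n by rewrite card_imset ?card_ord.
rewrite (bigD1 S) ?cardS //= big1 => [|s].
  rewrite addr0 comp_lfunE !dualE; congr (altform_fun w _).
  by apply/ffunP => i; rewrite !ffunE lfunE /= projset_basis // imset_f.
case/andP => /eqP cards sg; rewrite comp_lfunE !dualE.
(* As [s] and [S] have equal size but differ, some [g i] lies outside [s]; the projection sends that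
   basis vector to [0]. *)
have /subsetPn[_ /imsetP[i _ ->] gis] : ~~ (S \subset s).
  by apply: contra sg => gs; rewrite eq_sym eqEcard gs cardS cards leqnn.
apply: (multilinear_eq0_at (i := i) (altform_multilinear w)).
by rewrite !ffunE lfunE /= projset_basis // (negbTE gis).
Qed.

End DualBasis.

Theorem theorem1 (R : realType) (U V W : vectType R)
    (B : 'Hom(U, V)) (A : 'Hom(V, W)) (n : nat) (n_gt0 : (0 < n)%N)
    (N : nat) (dimV : \dim (fullv : {vspace V}) = N)
    (f : N.-tuple V) (f_basis : basis_of fullv f) :
  dual n (A \o B)%VF =
    \sum_(s : {set 'I_N} | #|s| == n)
      (dual n (projset f s \o B)%VF \o dual n (A \o inclset f s)%VF)%VF.
Proof.
(* The dual reverses composition, so the left side is [dual n B] after [dual n A]; the identity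
   inserted between them is expanded as the sum over [s]. *)
rewrite dual_comp -[dual n A in LHS]comp_lfun1l -(dual_projset_sum n f_basis).
rewrite (big_morph _ (fun g h => comp_lfunDl g h _) (comp_lfun0l _ _)).
rewrite (big_morph _ (comp_lfunDr _) (comp_lfun0r _ _)); apply: eq_bigr => s _.
by rewrite !dual_comp !comp_lfunA.
Qed.
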